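(* Let $P \subseteq [0,1]^n$ be a solvable convex body, let $G\colon [0,1]^n \to \mathbb{R}$ be a non-negative, monotone, $L$-smooth DR-submodular function, let $C\colon [0,1]^n \to \mathbb{R}$ be a non-negative, monotone, $L$-smooth concave function, and let $F = G + C$. Let $\mathbf{o} \in \arg\max_{\mathbf{x}\in P} F(\mathbf{x})$, $D = \max_{\mathbf{x}\in P}\|\mathbf{x}\|_2$, and let $\varepsilon \in (0,1)$ be such that $\varepsilon^{-1}$ is an integer. Let $S$ be the time it takes to find a point in $P$ maximizing a given linear function. Then the algorithm Greedy Frank-Wolfe (defined in the context) with parameter $\varepsilon$ runs in $O(\varepsilon^{-1}(n+S))$ time, makes $O(1/\varepsilon)$ calls to the gradient oracle (of $F$), and outputs a vector $\mathbf{y}$ such that $$F(\mathbf{y}) \ge (1-1/e)\cdot F(\mathbf{o}) - O(\varepsilon L D^2).$$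
   Context: Inequalities between vectors hold coordinate-wise; $\langle\cdot,\cdot\rangle$ is the standard Euclidean inner product; $\mathbf{e}_i$ is the $i$-th standard basis vector. A function $G\colon[0,1]^n\to\mathbb{R}$ is DR-submodular if for all $\mathbf{a},\mathbf{b}\in[0,1]^n$ with $\mathbf{a}\le\mathbf{b}$, every $k>0$ and every $i\in\{1,\dots,n\}$ with $\mathbf{a}+k\mathbf{e}_i,\mathbf{b}+k\mathbf{e}_i\in[0,1]^n$, one has $G(\mathbf{a}+k\mathbf{e}_i)-G(\mathbf{a})\ge G(\mathbf{b}+k\mathbf{e}_i)-G(\mathbf{b})$. A function $f$ is $L$-smooth if it is differentiable and $\|\nabla f(\mathbf{a})-\nabla f(\mathbf{b})\|_2\le L\|\mathbf{a}-\mathbf{b}\|_2$ for all $\mathbf{a},\mathbf{b}\in[0,1]^n$. A function $f$ is monotone if $\mathbf{a}\le\mathbf{b}$ implies $f(\mathbf{a})\le f(\mathbf{b})$. $P$ is solvable if one can efficiently optimize linear functions over it. $O(\cdot)$ hides universal constants; gradient-oracle calls are counted separately from the running time. Algorithm Greedy Frank-Wolfe ($\varepsilon$): set $t\gets 0$ and $\mathbf{y}^{(0)}\gets\mathbf{0}$ (all-zeros vector). While $t<1$: let $\mathbf{s}^{(t)}\in\arg\max_{\mathbf{x}\in P}\langle\nabla F(\mathbf{y}^{(t)}),\mathbf{x}\rangle$; set $\mathbf{y}^{(t+\varepsilon)}\gets\mathbf{y}^{(t)}+\varepsilon\cdot\mathbf{s}^{(t)}$; set $t\gets t+\varepsilon$.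 Return $\mathbf{y}^{(1)}$. *)

(* Defs.v *)
From mathcomp Require Import all_boot all_order all_algebra.
From mathcomp Require Import all_classical all_reals all_analysis.
Import Order.TTheory GRing.Theory Num.Theory numFieldNormedType.Exports.

Set Implicit Arguments.
Unset Strict Implicit.
Unset Printing Implicit Defensive.

Local Open Scope classical_set_scope.
Local Open Scope ring_scope.

(** * Vectors and functions on the cube *)

Definition dotp (R : realType) (n : nat) (u v : 'rV[R]_n) : R :=
  \sum_i u 0 i * v 0 i.

(* The norm that the library puts on matrices is the maximum norm, hence a
   separate Euclidean norm. *)
Definition enorm (R : realType) (n : nat) (u : 'rV[R]_n) : R :=
  Num.sqrt (dotp u u).

Definition vle (R : realType) (n : nat) (u v : 'rV[R]_n) : Prop :=
  forall i, u 0 i <= v 0 i.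

Definition cube (R : realType) (n : nat) : set 'rV[R]_n :=
  [set x | forall i, 0 <= x 0 i <= 1].
Arguments cube : clear implicits.

(* A function [0,1]^n -> R is represented by a function on the whole of R^n;
   the predicates below depend only on its values on the cube. *)

Definition nonneg_on_cube (R : realType) (n : nat) (f : 'rV[R]_n -> R) : Prop :=
  forall a, cube R n a -> 0 <= f a.

Definition monotone_on_cube (R : realType) (n : nat) (f : 'rV[R]_n -> R) :
    Prop :=
  forall a b, cube R n a -> cube R n b -> vle a b -> f a <= f b.

Definition DR_submodular (R : realType) (n : nat) (f : 'rV[R]_n -> R) : Prop :=
  forall a b, cube R n a -> cube R n b -> vle a b ->
  forall (k : R) (i : 'I_n), 0 < k ->
    cube R n (a + k *: delta_mx 0 i) -> cube R n (b + k *: delta_mx 0 i) ->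
    f (a + k *: delta_mx 0 i) - f a >= f (b + k *: delta_mx 0 i) - f b.

Definition concave_on_cube (R : realType) (n : nat) (f : 'rV[R]_n -> R) :
    Prop :=
  convex_function (cube R n) (\- f).

(* Differentiability is relative to the cube: one-sided on the boundary. Since
   the cube has nonempty interior, at most one vector g has this property. *)
Definition is_gradient (R : realType) (n : nat) (f : 'rV[R]_n -> R)
    (a g : 'rV[R]_n) : Prop :=
  forall e : R, 0 < e -> \forall b \near within (cube R n) (nbhs a),
    `|f b - f a - dotp g (b - a)| <= e * enorm (b - a).

Definition grad (R : realType) (n : nat) (f : 'rV[R]_n -> R)
    (a : 'rV[R]_n) : 'rV[R]_n :=
  get (is_gradient f a).

Definition smooth (R : realType) (n : nat) (L : R) (f : 'rV[R]_n -> R) : Prop :=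
  (forall a, cube R n a -> exists g, is_gradient f a g) /\
  (forall a b, cube R n a -> cube R n b ->
     enorm (grad f a - grad f b) <= L * enorm (a - b)).

Definition convex_body (R : realType) (n : nat) (P : set 'rV[R]_n) : Prop :=
  [/\ P !=set0, compact P & convex_set P].

Definition argmax (R : realType) (T : Type) (P : set T) (f : T -> R) : set T :=
  [set x | P x /\ forall y, P y -> f y <= f x].

Definition is_max (R : realType) (T : Type) (P : set T) (f : T -> R) (m : R) :
    Prop :=
  exists2 x, argmax P f x & f x = m.

(* [lmo k c] is the answer to the k-th call of the procedure that maximizes
   linear functions over P, when the objective of that call is <c, .>. The
   dependence on k lets ties be broken differently from one call to the next,
   so that every run with s^(t) in the argmax is covered. *)
Definition linear_maximizer (R : realType) (n : nat) (P : set 'rV[R]_n)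
    (lmo : nat -> 'rV[R]_n -> 'rV[R]_n) : Prop :=
  forall k c, argmax P (dotp c) (lmo k c).

(** * A real-RAM language with two oracles

   Scalar and vector registers are indexed by nat. Each elementary operation
   (reading a literal, a register or a coordinate, an addition, a
   multiplication, a comparison, a write, a step of a coordinate loop) takes
   one unit of time. A linear maximization takes S_lin units. A gradient query
   takes no time and is counted apart. *)

Inductive expr (R : realType) (n : nat) : Type :=
| Lit of R
| Scal of nat
| Coord of nat & 'I_n
| Add of expr R n & expr R n
| Mul of expr R n & expr R n.
Arguments Lit {R n}.
Arguments Scal {R n}.
Arguments Coord {R n}.

Inductive cmd (R : realType) (n : nat) : Type :=
| SetScal of nat & expr R n
| SetCoord of nat & 'I_n & expr R n
| Seq of cmd R n & cmd R n
| ForCoord of ('I_n -> cmd R n)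
| WhileLt of expr R n & expr R n & cmd R n
| QueryGrad of nat & nat                (* target, argument *)
| MaxLinear of nat & nat.               (* target, objective *)
Arguments QueryGrad {R n}.
Arguments MaxLinear {R n}.

Record state (R : realType) (n : nat) : Type := State {
  sreg : nat -> R;
  vreg : nat -> 'rV[R]_n;
  clock : nat;
  grad_calls : nat;
  lmo_calls : nat }.

Definition init_state (R : realType) (n : nat) : state R n :=
  State (fun=> 0) (fun=> 0) 0 0 0.
Arguments init_state : clear implicits.

Definition upd (T : Type) (f : nat -> T) (a : nat) (x : T) : nat -> T :=
  fun b => if b == a then x else f b.

Definition upd_coord (R : realType) (n : nat) (u : 'rV[R]_n) (i : 'I_n)
    (x : R) : 'rV[R]_n :=
  \row_j (if j == i then x else u 0 j).

Definition tick (R : realType) (n : nat) (d : nat) (st : state R n) :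
    state R n :=
  State (sreg st) (vreg st) (clock st + d)%N (grad_calls st) (lmo_calls st).

Fixpoint eval_expr (R : realType) (n : nat) (st : state R n) (e : expr R n) : R :=
  match e with
  | Lit r => r
  | Scal a => sreg st a
  | Coord v i => vreg st v 0 i
  | Add e1 e2 => eval_expr st e1 + eval_expr st e2
  | Mul e1 e2 => eval_expr st e1 * eval_expr st e2
  end.

Fixpoint cost (R : realType) (n : nat) (e : expr R n) : nat :=
  match e with
  | Lit _ | Scal _ | Coord _ _ => 1
  | Add e1 e2 | Mul e1 e2 => (cost e1 + cost e2)%N.+1
  end.

(* [run g lmo S_lin fuel c st] is the state in which c, started in st,
   terminates, or None if the fuel does not suffice to reach the end. The fuel bounds the
   depth of the recursive calls and has no relation to the measured time. *)
Fixpoint run (R : realType) (n : nat) (g : 'rV[R]_n -> 'rV[R]_n)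
    (lmo : nat -> 'rV[R]_n -> 'rV[R]_n) (S_lin : nat) (fuel : nat)
    (c : cmd R n) (st : state R n) : option (state R n) :=
  if fuel isn't k.+1 then None else
  match c with
  | SetScal a e =>
      Some (State (upd (sreg st) a (eval_expr st e)) (vreg st)
                  (clock st + (cost e).+1)%N (grad_calls st) (lmo_calls st))
  | SetCoord v i e =>
      Some (State (sreg st)
                  (upd (vreg st) v (upd_coord (vreg st v) i (eval_expr st e)))
                  (clock st + (cost e).+1)%N (grad_calls st) (lmo_calls st))
  | Seq c1 c2 => obind (run g lmo S_lin k c2) (run g lmo S_lin k c1 st)
  | ForCoord body =>
      foldl (fun o i =>
               obind (fun st' => run g lmo S_lin k (body i) (tick 1 st')) o)
            (Some st) (enum 'I_n)
  | WhileLt e1 e2 body =>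
      let st' := tick (cost e1 + cost e2)%N.+1 st in
      if eval_expr st e1 < eval_expr st e2
      then obind (run g lmo S_lin k c) (run g lmo S_lin k body st')
      else Some st'
  | QueryGrad v w =>
      Some (State (sreg st) (upd (vreg st) v (g (vreg st w)))
                  (clock st) (grad_calls st).+1 (lmo_calls st))
  | MaxLinear v w =>
      Some (State (sreg st) (upd (vreg st) v (lmo (lmo_calls st) (vreg st w)))
                  (clock st + S_lin)%N (grad_calls st) (lmo_calls st).+1)
  end.

(** * Greedy Frank-Wolfe *)

Definition t_reg : nat := 0.  (* scalar register *)
Definition y_reg : nat := 0.  (* vector registers *)
Definition g_reg : nat := 1.
Definition s_reg : nat := 2.

Definition greedy_frank_wolfe (R : realType) (n : nat) (eps : R) : cmd R n :=
  Seq (SetScal t_reg (Lit 0))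
  (Seq (ForCoord (fun i => SetCoord y_reg i (Lit 0)))
  (WhileLt (Scal t_reg) (Lit 1)
    (Seq (QueryGrad g_reg y_reg)
    (Seq (MaxLinear s_reg g_reg)
    (Seq (ForCoord (fun i => SetCoord y_reg i
            (Add (Coord y_reg i) (Mul (Lit eps) (Coord s_reg i)))))
    (SetScal t_reg (Add (Scal t_reg) (Lit eps)))))))).

Definition output (R : realType) (n : nat) (st : state R n) : 'rV[R]_n :=
  vreg st y_reg.

(* Main.v *)
Require Import Defs.
From mathcomp Require Import all_boot all_order all_algebra.
From mathcomp Require Import all_classical all_reals all_analysis.
From mathcomp Require Import ring lra zify.
Import Order.TTheory GRing.Theory Num.Theory numFieldNormedType.Exports.
Local Open Scope classical_set_scope.
Local Open Scope ring_scope.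

(** Let y be an iterate, s the vector that the linear maximization returns, and
    M = L D^2. The theorem rests on the inequality

      F (y + eps s) - F y >= eps (F o - F y) - 2 eps^2 M,

    which is [greedy_step]. It says that one step shrinks the gap F o - F y by
    the factor 1 - eps, up to an additive error. After m = 1/eps steps from the
    origin, where F is nonnegative, the gap is at most
    (1 - eps)^m F o + m * 2 eps^2 M <= F o / e + 2 eps M, because
    1 - eps <= exp (- eps).

    The step inequality has three ingredients.
    - Smoothness ([smooth_ascent]): moving by eps s gains at least
      eps <grad F y, s> - 2 eps^2 M, a loss of eps^2 M for each of G and C.
    - Greediness: <grad F y, s> >= <grad F y, o>, as o belongs to P.
    - First-order progress towards o: <grad G y, o> >= G o - G y ([DR_gain])
      and <grad C y, o> >= C o - C y ([concave_gain]). A DR-submodular function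
      is below its tangent along nonnegative directions ([DR_le_gradient]), so
      one compares y with the join of y and o, which dominates o; a concave one
      is below its tangent in every direction. In both cases the leftover is
      the scalar product of the gradient with a vector between 0 and y. It is
      nonnegative because the function increases when that vector is added
      back ([monotone_gradient_ge0]).

    Gradients are relative to the cube, so on its boundary only feasible
    directions carry information. Statements about a gradient are therefore
    obtained from difference quotients along segments of the cube: see
    [directional_cvg].

    The running time follows from the execution of the program in closed form:
    [run_greedy_frank_wolfe] identifies its output with the m-th term of the
    recurrence [fw_iter] and counts its steps exactly. *)

Set Implicit Arguments.
Unset Strict Implicit.
Unset Printing Implicit Defensive.

(** * Euclidean geometry of row vectors *)

Section Euclidean.
Context {R : realType} {n : nat}.
Implicit Types (u v w : 'rV[R]_n) (c : R).

Lemma dotpC u v : dotp u v = dotp v u.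
Proof. by apply: eq_bigr => i _; rewrite mulrC. Qed.

Lemma dotpDr u v w : dotp u (v + w) = dotp u v + dotp u w.
Proof. by rewrite -big_split; apply: eq_bigr => i _; rewrite mxE mulrDr. Qed.

Lemma dotpZr u c v : dotp u (c *: v) = c * dotp u v.
Proof. by rewrite mulr_sumr; apply: eq_bigr => i _; rewrite mxE mulrCA. Qed.

Lemma dotpZl u c v : dotp (c *: u) v = c * dotp u v.
Proof. by rewrite !(dotpC _ v) dotpZr. Qed.

Lemma dotpNr u v : dotp u (- v) = - dotp u v.
Proof. by rewrite -scaleN1r dotpZr mulN1r. Qed.

Lemma dotpBr u v w : dotp u (v - w) = dotp u v - dotp u w.
Proof. by rewrite dotpDr dotpNr. Qed.

Lemma dotpBl u v w : dotp (u - v) w = dotp u w - dotp v w.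
Proof. by rewrite !(dotpC _ w) dotpBr. Qed.

Lemma dotpDl u v w : dotp (u + v) w = dotp u w + dotp v w.
Proof. by rewrite !(dotpC _ w) dotpDr. Qed.

Lemma dotp_delta u i : dotp u (delta_mx 0 i) = u 0 i.
Proof.
rewrite /dotp (bigD1 i)//= mxE !eqxx mulr1 big1 ?addr0// => j ji.
by rewrite mxE (negbTE ji) andbF mulr0.
Qed.

Lemma dotpp_ge0 u : 0 <= dotp u u.
Proof. by apply: sumr_ge0 => i _; rewrite -expr2 sqr_ge0. Qed.

Lemma enorm_ge0 u : 0 <= enorm u.
Proof. exact: sqrtr_ge0. Qed.

Lemma enorm_sqr u : enorm u ^+ 2 = dotp u u.
Proof. by rewrite sqr_sqrtr// dotpp_ge0. Qed.

Lemma enormZ c u : enorm (c *: u) = `|c| * enorm u.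
Proof.
by rewrite /enorm dotpZr dotpZl mulrA -expr2 sqrtrM ?sqr_ge0// sqrtr_sqr.
Qed.

Lemma enorm_gt0 u : u != 0 -> 0 < enorm u.
Proof.
move=> u0; rewrite sqrtr_gt0 lt_neqAle dotpp_ge0 andbT eq_sym.
apply: contra u0 => /eqP u0; apply/eqP/rowP => i.
have ge0 j : true -> 0 <= u 0 j * u 0 j by rewrite -expr2 sqr_ge0.
have /eqP := psumr_eq0P ge0 u0 (i := i) isT.
by rewrite mulf_eq0 orbb mxE => /eqP.
Qed.

(** Cauchy-Schwarz: expand the square of <v, v> u - <u, v> v. *)
Lemma dotp_le_enorm u v : `|dotp u v| <= enorm u * enorm v.
Proof.
have [->|v0] := eqVneq v 0.
  by rewrite -(scale0r 0) dotpZr enormZ normr0 !mul0r normr0 mulr0.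
have vv : 0 < dotp v v by rewrite -enorm_sqr exprn_gt0// enorm_gt0.
rewrite -(@ler_pXn2r _ 2) ?nnegrE ?mulr_ge0 ?enorm_ge0//.
rewrite exprMn !enorm_sqr real_normK ?num_real//.
have := dotpp_ge0 (dotp v v *: u - dotp u v *: v).
rewrite dotpBl !dotpBr !dotpZl !dotpZr (dotpC v u).
set x := dotp u u; set y := dotp u v; set z := dotp v v in vv *.
have -> : z * (z * x) - z * (y * y) - (y * (z * y) - y * (y * z)) =
  z * (x * z - y ^+ 2) by ring.
by rewrite pmulr_rge0// subr_ge0.
Qed.

End Euclidean.

(** * Gradients relative to the cube *)

Section Gradient.
Context {R : realType} {n : nat}.
Implicit Types (f : 'rV[R]_n -> R) (a b d g u x : 'rV[R]_n) (e h t : R).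

Lemma gradientP f a : (exists g, is_gradient f a g) ->
  is_gradient f a (grad f a).
Proof. exact: getPex. Qed.

Lemma is_gradientD f1 f2 a g1 g2 : is_gradient f1 a g1 -> is_gradient f2 a g2 ->
  is_gradient (fun x => f1 x + f2 x) a (g1 + g2).
Proof.
move=> f1g f2g e e0; have e2 : 0 < e / 2 by rewrite divr_gt0.
apply: filterS2 (f1g _ e2) (f2g _ e2) => b f1b f2b /=; rewrite dotpDl.
rewrite [X in _ <= X * _]splitr mulrDl.
apply: le_trans (lerD f1b f2b); apply: le_trans (ler_normD _ _).
by rewrite le_eqVlt; apply/orP; left; apply/eqP; congr (`|_|); ring.
Qed.

Lemma cube_segment a d t : cube R n a -> cube R n (a + d) -> 0 <= t <= 1 ->
  cube R n (a + t *: d).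
Proof.
move=> ca cad t01 i; have := cad i; have := ca i; rewrite !mxE; nra.
Qed.

(** The constant [enorm d] is absorbed into [e], which leaves an estimate in the
    scalar [h] alone. *)
Lemma is_gradient_line f a g d e : is_gradient f a g -> 0 < e ->
  \forall h \near 0, cube R n (a + h *: d) ->
    `|f (a + h *: d) - f a - h * dotp g d| <= e * `|h|.
Proof.
move=> fg e0; have d1 : 0 < enorm d + 1 by rewrite ltr_wpDl ?enorm_ge0.
have line : a + h *: d @[h --> (0 : R)] --> a.
  rewrite -[X in _ --> X]addr0 -(scale0r d).
  by apply: cvgD; [exact: cvg_cst|apply: cvgZr_tmp; exact: cvg_id].
have near0 : \forall h \near (0 : R), cube R n (a + h *: d) ->
    `|f (a + h *: d) - f a - dotp g (a + h *: d - a)|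
      <= e / (enorm d + 1) * enorm (a + h *: d - a).
  exact: line _ (fg _ (divr_gt0 e0 d1)).
apply: filterS near0 => h near0 ch; move: (near0 ch).
rewrite [a + h *: d - a]addrC addKr dotpZr enormZ.
move/le_trans; apply; rewrite mulrCA mulrC ler_wpM2r//.
rewrite -mulrA ler_piMr ?(ltW e0)// mulrC ler_pdivrMr// mul1r.
by rewrite lerDl.
Qed.

(** Stated for any filter [U] finer than the punctured neighbourhoods of 0 along
    which the line stays in the cube: at an interior point of a segment [U] is
    two-sided, and at an end point it is one-sided. *)
Lemma difference_quotient_cvg f a g d (U : set_system R) {FU : Filter U} :
  is_gradient f a g -> U `=>` 0^' -> (\forall h \near U, cube R n (a + h *: d)) ->
  h^-1 * (f (a + h *: d) - f a) @[h --> U] --> dotp g d.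
Proof.
move=> fg U0 cU; apply/cvgrPdist_le => e e0.
have Uneq : \forall h \near U, h != 0 by apply: U0; exact: (nbhs_dnbhs_neq (0 : R)).
have Uline : \forall h \near U, cube R n (a + h *: d) ->
    `|f (a + h *: d) - f a - h * dotp g d| <= e * `|h|.
  by apply: U0; apply: nbhs_dnbhs; exact: is_gradient_line.
near=> h; have h0 : h != 0 by near: h.
have ch : cube R n (a + h *: d) by near: h.
have : `|f (a + h *: d) - f a - h * dotp g d| <= e * `|h|.
  by move: ch; near: h.
rewrite -ler_pdivrMr ?normr_gt0// -normfV -normrM; apply: le_trans.
rewrite -normrN le_eqVlt; apply/orP; left; apply/eqP; congr (`|_|).
by field.
Unshelve. all: by end_near. Qed.

(** The main source of information on a gradient: if [a] and [a + d] belong to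
    the cube, so does the segment between them, and the slope of [f] along it
    at [a] is <g, d>. *)
Lemma directional_cvg f a g d :
  is_gradient f a g -> cube R n a -> cube R n (a + d) ->
  h^-1 * (f (a + h *: d) - f a) @[h --> 0^'+] --> dotp g d.
Proof.
move=> fg ca cad; apply: difference_quotient_cvg fg _ _.
  by apply: within_subset => x /=; exact: lt0r_neq0.
near=> h; apply: cube_segment => //.
by apply/andP; split; near: h; [exact: nbhs_right_ge|exact: nbhs_right_le].
Unshelve. all: by end_near. Qed.

Lemma directional_le f a g d r :
  is_gradient f a g -> cube R n a -> cube R n (a + d) ->
  (forall h, 0 < h <= 1 -> f (a + h *: d) - f a <= h * r) -> dotp g d <= r.
Proof.
move=> fg ca cad fr; apply: cvgr_to_le (directional_cvg fg ca cad) _.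
near=> h; have h0 : 0 < h by near: h; exact: nbhs_right_gt.
rewrite mulrC ler_pdivrMr// mulrC; apply: fr; rewrite h0.
by near: h; exact: nbhs_right_le.
Unshelve. all: by end_near. Qed.

Lemma directional_ge f a g d r :
  is_gradient f a g -> cube R n a -> cube R n (a + d) ->
  (forall h, 0 < h <= 1 -> h * r <= f (a + h *: d) - f a) -> r <= dotp g d.
Proof.
move=> fg ca cad fr; apply: cvgr_to_ge (directional_cvg fg ca cad) _.
near=> h; have h0 : 0 < h by near: h; exact: nbhs_right_gt.
rewrite mulrC ler_pdivlMr// mulrC; apply: fr; rewrite h0.
by near: h; exact: nbhs_right_le.
Unshelve. all: by end_near. Qed.

Lemma directional_mono f1 f2 a1 a2 g1 g2 d :
  is_gradient f1 a1 g1 -> is_gradient f2 a2 g2 ->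
  cube R n a1 -> cube R n a2 -> cube R n (a1 + d) -> cube R n (a2 + d) ->
  (forall h, 0 < h <= 1 -> f1 (a1 + h *: d) - f1 a1 <= f2 (a2 + h *: d) - f2 a2) ->
  dotp g1 d <= dotp g2 d.
Proof.
move=> fg1 fg2 ca1 ca2 cad1 cad2 le12.
apply: ler_cvg_to (directional_cvg fg1 ca1 cad1) (directional_cvg fg2 ca2 cad2) _.
near=> h; have h0 : 0 < h by near: h; exact: nbhs_right_gt.
rewrite ler_pM2l ?invr_gt0//; apply: le12; rewrite h0.
by near: h; exact: nbhs_right_le.
Unshelve. all: by end_near. Qed.

(** Both products are the limit of the same difference quotients. Thus the
    gradient of a sum and the sum of the gradients agree on feasible
    directions. *)
Lemma directional_uniq f a g1 g2 d :
  is_gradient f a g1 -> is_gradient f a g2 -> cube R n a -> cube R n (a + d) ->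
  dotp g1 d = dotp g2 d.
Proof.
move=> fg1 fg2 ca cad; apply/le_anti/andP.
by split; [apply: (directional_mono fg1 fg2)|apply: (directional_mono fg2 fg1)].
Qed.

(** The mean value theorem for [f] restricted to the segment: inside it the slope
    is the two-sided limit of difference quotients, even where the segment lies
    in the boundary of the cube. *)
Lemma gradient_mvt f a d : (forall x, cube R n x -> exists g, is_gradient f x g) ->
  cube R n a -> cube R n (a + d) ->
  exists2 t, 0 < t < 1 & f (a + d) - f a = dotp (grad f (a + t *: d)) d.
Proof.
move=> fd ca cad; pose phi t := f (a + t *: d).
have shiftE t h : a + t *: d + h *: d = a + (h + t) *: d.
  by rewrite -addrA -scalerDl (addrC t).
have ct t : 0 <= t <= 1 -> cube R n (a + t *: d) by exact: cube_segment.
have gt t : 0 <= t <= 1 -> is_gradient f (a + t *: d) (grad f (a + t *: d)).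
  by move=> t01; exact/gradientP/fd/ct.
(* The whole segment is in the cube, so the quotient is two-sided at [t]. *)
have der t : t \in `]0, 1[ -> is_derive t 1 phi (dotp (grad f (a + t *: d)) d).
  move=> t01; have t01' : 0 <= t <= 1 by move: t01; rewrite in_itv/=; lra.
  have : h^-1 *: ((phi \o shift t) (h *: 1) - phi t) @[h --> 0^'] -->
      dotp (grad f (a + t *: d)) d.
    have -> : (fun h => h^-1 *: ((phi \o shift t) (h *: 1) - phi t)) =
        (fun h => h^-1 * (f (a + t *: d + h *: d) - f (a + t *: d))).
      by apply/funext => h /=; rewrite shiftE /phi [h *: 1]mulr1.
    apply: difference_quotient_cvg (gt _ t01') _ _ => //.
    have cvt : h + t @[h --> (0 : R)] --> t.
      by rewrite -[X in _ --> X]add0r; apply: cvgD; [exact: cvg_id|exact: cvg_cst].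
    have near01 : \forall h \near (0 : R), h + t \in `]0, 1[.
      exact: cvt _ (near_in_itvoo t01).
    apply: nbhs_dnbhs; apply: filterS near01 => h; rewrite in_itv/= => h01.
    by rewrite shiftE; apply: ct; lra.
  move=> lim; apply: DeriveDef.
    by apply/cvg_ex; exists (dotp (grad f (a + t *: d)) d).
  exact: cvg_lim lim.
(* Being differentiable, phi is locally Lipschitz, with constant
   1 + |<g, d>|. *)
have cont : {within `[0, 1], continuous phi}.
  apply/subspace_continuousP => t /=; rewrite in_itv/= => t01.
  set g := grad f (a + t *: d); apply/cvgrPdist_le => e e0.
  have K0 : 0 < 1 + `|dotp g d| by rewrite ltr_pwDl.
  have cvt : s - t @[s --> t] --> (0 : R).
    by rewrite -[X in _ --> X](subrr t); apply: cvgB; [exact: cvg_id|exact: cvg_cst].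
  have lip : \forall s \near t, cube R n (a + t *: d + (s - t) *: d) ->
      `|f (a + t *: d + (s - t) *: d) - f (a + t *: d) - (s - t) * dotp g d|
        <= 1 * `|s - t|.
    exact: cvt _ (is_gradient_line d (gt _ t01) ltr01).
  have close : \forall s \near t, `|s - t| <= e / (1 + `|dotp g d|).
    have : \forall h \near (0 : R), `|h| <= e / (1 + `|dotp g d|).
      by apply: nbhs0_le; rewrite divr_gt0.
    exact: cvt.
  apply: filterS2 lip close => s lip close; rewrite /= in_itv/= => s01.
  move: lip; rewrite shiftE subrK => /(_ (ct _ s01)); rewrite -/(phi s) -/(phi t).
  rewrite mul1r => lip; rewrite distrC.
  rewrite -(subrK ((s - t) * dotp g d) (phi s - phi t)).
  rewrite (le_trans (ler_normD _ _))// (le_trans (lerD lip (lexx _)))//.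
  rewrite normrM -[X in X + _]mulr1 -mulrDr.
  by rewrite -ler_pdivlMr.
have [t t01 E] := MVT ltr01 der cont.
exists t; first by move: t01; rewrite in_itv.
by move: E; rewrite /phi scale1r scale0r addr0 subr0 mulr1.
Qed.

(** The segment from [a] to [a - u] stays in the cube, and [f] decreases along
    it. Going backwards makes the lemma valid also where [a] touches the upper
    faces of the cube and [a + u] would leave it. *)
Lemma monotone_gradient_ge0 f a g u : monotone_on_cube f -> is_gradient f a g ->
  cube R n a -> (forall i, 0 <= u 0 i <= a 0 i) -> 0 <= dotp g u.
Proof.
move=> fm fg ca ua; rewrite -oppr_le0 -dotpNr.
have cau : cube R n (a - u).
  by move=> i; have := ca i; have := ua i; rewrite !mxE; lra.
apply: (directional_le fg ca cau) => h /andP[h0 h1].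
rewrite mulr0 subr_le0; apply: fm => //.
  by apply: cube_segment => //; rewrite (ltW h0).
by move=> i; have := ua i; rewrite !mxE; nra.
Qed.

(** By concavity the chord slope on [a, a + h d] is at least the one on
    [a, a + d]. *)
Lemma concave_le_gradient f a g d : concave_on_cube f -> is_gradient f a g ->
  cube R n a -> cube R n (a + d) -> f (a + d) - f a <= dotp g d.
Proof.
move=> fc fg ca cad; apply: (directional_ge fg ca cad) => h /andP[/ltW h0 h1].
have := fc (Itv01 h0 h1) (a + d) a (mem_set cad) (mem_set ca).
rewrite convRE.
have -> : conv (Itv01 h0 h1) (a + d : convex_lmodType _) a = a + h *: d.
  rewrite -[LHS]/(h *: (a + d) + (1 - h) *: a).
  by rewrite scalerDr addrAC -scalerDl subrKC scale1r.
rewrite -[X in _ <= X]/(h * - f (a + d) + (1 - h) * - f a).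
rewrite -[X in X <= _]/(- f (a + h *: d)).
lra.
Qed.

(** DR-submodularity compares the forward quotients at [a] and at [b] in
    direction [i]. The bound [b 0 i < 1] makes room for a forward step at [b],
    hence also at [a]. *)
Lemma DR_gradient_antitone f a b i : DR_submodular f ->
  is_gradient f a (grad f a) -> is_gradient f b (grad f b) ->
  cube R n a -> cube R n b -> vle a b -> b 0 i < 1 ->
  grad f b 0 i <= grad f a 0 i.
Proof.
move=> fDR fa fb ca cb ab bi1; set k := 1 - b 0 i.
have k0 : 0 < k by rewrite subr_gt0.
have room x h : cube R n x -> x 0 i <= b 0 i -> 0 <= h <= k ->
    cube R n (x + h *: delta_mx 0 i).
  move=> cx xb hk j; have := cx j; rewrite !mxE eqxx/=.
  by have [->|_] := eqVneq j i; rewrite /= ?mulr1 ?mulr0; move: hk; rewrite /k; lra.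
have kk : 0 <= k <= k by rewrite lexx ltW.
rewrite -(ler_pM2l k0) -!dotp_delta -!dotpZr.
apply: (directional_mono fb fa) => //; try exact: room.
move=> h /andP[h0 h1]; rewrite scalerA.
have hk : 0 <= h * k <= k by nra.
by apply: fDR => //; [exact: mulr_gt0|exact: room..].
Qed.

(** On the segment the slope is the gradient at some later point, whose
    coordinates are at most those of the gradient at [a]. *)
Lemma DR_le_gradient f a d : (forall x, cube R n x -> exists g, is_gradient f x g) ->
  DR_submodular f -> cube R n a -> cube R n (a + d) -> (forall i, 0 <= d 0 i) ->
  f (a + d) - f a <= dotp (grad f a) d.
Proof.
move=> fd fDR ca cad d0; have [t t01 ->] := gradient_mvt fd ca cad.
have ct : cube R n (a + t *: d) by apply: cube_segment => //; lra.
apply: ler_sum => i _; have := d0 i; rewrite le_eqVlt => /predU1P[<-|di0].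
  by rewrite !mulr0.
(* If d_i > 0 then a + t d is strictly below the face x_i = 1, as t < 1. *)
rewrite ler_pM2r//; apply: DR_gradient_antitone => //; try exact/gradientP/fd.
  by move=> j; have := d0 j; rewrite !mxE; nra.
by have := cad i; rewrite !mxE; nra.
Qed.

(** The slope at the intermediate point of the mean value theorem differs from
    that at [a] by at most [L * enorm d ^+ 2]; integrating instead would give
    half of this. *)
Lemma smooth_ascent f L a d : smooth L f -> cube R n a -> cube R n (a + d) ->
  dotp (grad f a) d - L * enorm d ^+ 2 <= f (a + d) - f a.
Proof.
move=> [fd fL] ca cad; have [t t01 ->] := gradient_mvt fd ca cad.
have ct : cube R n (a + t *: d) by apply: cube_segment => //; lra.
(* The sign of L is read off the Lipschitz bound between the end points. *)
have Ld : 0 <= L * enorm d.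
  by rewrite (le_trans (enorm_ge0 _) (le_trans (fL _ _ cad ca) _))// addrC addKr.
have := fL _ _ ct ca; rewrite [a + t *: d - a]addrC addKr enormZ => tL.
have := dotp_le_enorm (grad f (a + t *: d) - grad f a) d.
rewrite ler_norml dotpBl => /andP[+ _]; move: tL.
rewrite ger0_norm; last lra.
set u := enorm (_ - _) => tL.
have /ler_wpM2r-/(_ _ (enorm_ge0 d)) : u <= L * enorm d by nra.
by rewrite -mulrA -expr2; lra.
Qed.

End Gradient.

(** The cube contains two distinct points as soon as [n] is positive. *)
Lemma smooth_const_ge0 (R : realType) (n : nat) (L : R) (f : 'rV[R]_n -> R) :
  (0 < n)%N -> smooth L f -> 0 <= L.
Proof.
case: n f => // n f _ [_ fL].
pose u : 'rV[R]_n.+1 := delta_mx 0 0.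
have c0 : cube R n.+1 0 by move=> i; rewrite mxE lexx ler01.
have cu : cube R n.+1 u.
  by move=> i; rewrite mxE eqxx /=; case: eqP; rewrite ?lexx ?ler01.
have u0 : 0 < enorm (u - 0).
  rewrite subr0 enorm_gt0//; apply/eqP => /rowP/(_ 0); rewrite !mxE !eqxx/=.
  by move/eqP; rewrite oner_eq0.
by rewrite -(pmulr_lge0 _ u0); apply: le_trans (fL _ _ cu c0); exact: enorm_ge0.
Qed.

(** * Progress of one greedy step *)

Section Step.
Context {R : realType} {n : nat}.
Implicit Types (P : set 'rV[R]_n) (G C : 'rV[R]_n -> R) (y s o g : 'rV[R]_n).

(** With [m] the coordinatewise minimum of [y] and [o], the join of [y] and [o]
    is [y + (o - m)]. Hence G o - G y <= G (y + (o - m)) - G y, which is at most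
    <grad G y, o> - <grad G y, m>, and the last product is nonnegative. *)
Lemma DR_gain G y o : (forall x, cube R n x -> exists g, is_gradient G x g) ->
  monotone_on_cube G -> DR_submodular G -> cube R n y -> cube R n o ->
  G o - G y <= dotp (grad G y) o.
Proof.
move=> Gd Gm GDR cy co.
have [m mP] : exists m : 'rV[R]_n, forall i,
    [/\ 0 <= m 0 i, m 0 i <= y 0 i, m 0 i <= o 0 i & y 0 i + (o 0 i - m 0 i) <= 1].
  exists (\row_i Num.min (y 0 i) (o 0 i)) => i; move: (cy i) (co i).
  by rewrite mxE; case: (leP (y 0 i) (o 0 i)) => yo cyi coi; split; lra.
have cjoin : cube R n (y + (o - m)).
  by move=> i; case: (mP i) => ????; have := cy i; rewrite !mxE; lra.
have join_ge : G o <= G (y + (o - m)).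
  apply: Gm => // i; case: (mP i) => ????.
  by rewrite !mxE; lra.
have := DR_le_gradient Gd GDR cy cjoin.
have /[swap]/[apply] : forall i, 0 <= (o - m) 0 i.
  by move=> i; case: (mP i) => ????; rewrite !mxE; lra.
have : 0 <= dotp (grad G y) m.
  apply: monotone_gradient_ge0 Gm (gradientP (Gd _ cy)) cy _ => i.
  by case: (mP i) => ????; lra.
by rewrite dotpBr; lra.
Qed.

(** The tangent at [y] gives <grad C y, o - y>, and <grad C y, y> is nonnegative. *)
Lemma concave_gain C y o : (forall x, cube R n x -> exists g, is_gradient C x g) ->
  monotone_on_cube C -> concave_on_cube C -> cube R n y -> cube R n o ->
  C o - C y <= dotp (grad C y) o.
Proof.
move=> Cd Cm Cc cy co; have Cy := gradientP (Cd _ cy).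
have : 0 <= dotp (grad C y) y.
  by apply: (monotone_gradient_ge0 Cm Cy cy) => i; have := cy i; lra.
have := concave_le_gradient (d := o - y) Cc Cy cy.
by rewrite subrKC dotpBr => /(_ co); lra.
Qed.

(** The room left by [y <= 1 - eps] makes [eps *: x] a feasible direction at [y]
    for every [x] of [P]. This is what allows the gradient of [F], queried by the
    algorithm, to be split into those of [G] and [C]. *)
Lemma greedy_step P G C L D eps y s o : let F x := G x + C x in
  P `<=` cube R n ->
  monotone_on_cube G -> smooth L G -> DR_submodular G ->
  monotone_on_cube C -> smooth L C -> concave_on_cube C ->
  (forall x, P x -> enorm x <= D) -> 0 <= L -> 0 < eps ->
  (forall i, 0 <= y 0 i <= 1 - eps) -> P o -> argmax P (dotp (grad F y)) s ->
  F (y + eps *: s) - F y >= eps * (F o - F y) - 2 * (eps ^+ 2 * (L * D ^+ 2)).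
Proof.
move=> F PC Gm Gs GDR Cm Cs Cc PD L0 eps0 y1 Po [Ps smax].
have cy : cube R n y by move=> i; have := y1 i; lra.
have room x : P x -> cube R n (y + eps *: x).
  by move=> /PC cx i; have := cx i; have := y1 i; rewrite !mxE; nra.
have gG := gradientP (Gs.1 _ cy); have gC := gradientP (Cs.1 _ cy).
have gF := is_gradientD gG gC.
have FE x : P x -> dotp (grad F y) x = dotp (grad G y) x + dotp (grad C y) x.
  move=> Px.
  have := directional_uniq (gradientP (ex_intro _ _ gF)) gF cy (room _ Px).
  by rewrite !dotpZr dotpDl => /(mulfI (lt0r_neq0 eps0)).
have := smax _ Po; rewrite !FE// => smaxo.
have := DR_gain Gs.1 Gm GDR cy (PC _ Po).
have := concave_gain Cs.1 Cm Cc cy (PC _ Po).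
have := smooth_ascent Gs cy (room _ Ps); have := smooth_ascent Cs cy (room _ Ps).
rewrite !dotpZr enormZ ger0_norm ?(ltW eps0)// exprMn /F.
have sD : L * enorm s ^+ 2 <= L * D ^+ 2.
  by rewrite ler_wpM2l// lerXn2r ?nnegrE ?enorm_ge0 ?(le_trans (enorm_ge0 s)) ?PD.
move: (ler_wpM2l (sqr_ge0 eps) sD) => {}sD.
set Ds := dotp _ s in smaxo *; set Es := dotp _ s in smaxo *.
move=> HC HG HCo HGo.
have /(ler_wpM2l (ltW eps0)) : G o + C o - (G y + C y) <= Ds + Es by lra.
lra.
Qed.

End Step.

(** * Execution of the program *)

Section Run.
Context {R : realType} {n : nat}.
Context (g : 'rV[R]_n -> 'rV[R]_n) (lmo : nat -> 'rV[R]_n -> 'rV[R]_n).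
Context (S_lin : nat) (eps : R).

Lemma upd_upd T (f : nat -> T) a x y : upd (upd f a x) a y = upd f a y.
Proof. by apply/funext => b; rewrite /upd; case: eqP. Qed.

Lemma upd_same T (f : nat -> T) a x : upd f a x a = x.
Proof. by rewrite /upd eqxx. Qed.

Lemma upd_id T (f : nat -> T) a : upd f a (f a) = f.
Proof. by apply/funext => b; rewrite /upd; case: eqP => [->|]. Qed.

(** Since the i-th step writes coordinate [i] alone, the expression [e i] may read
    the register it updates: at that moment coordinate [i] still has its old
    value. A step takes one tick for the loop, one for the write, and the cost of
    the expression. *)
Lemma run_ForCoord_SetCoord k (st : state R n) v (e : 'I_n -> expr R n)
    (w : 'rV[R]_n) c :
  (forall i (u : 'rV[R]_n) t, u 0 i = vreg st v 0 i ->
    eval_expr (State (sreg st) (upd (vreg st) v u) t (grad_calls st)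
                 (lmo_calls st)) (e i) = w 0 i) ->
  (forall i, cost (e i) = c) ->
  run g lmo S_lin k.+2 (ForCoord (fun i => SetCoord v i (e i))) st =
  Some (State (sreg st) (upd (vreg st) v w) (clock st + n * c.+2)
          (grad_calls st) (lmo_calls st)).
Proof.
move=> ew ec.
(* The coordinates still to be visited, those in [s], are unchanged. *)
have loop s : uniq s -> forall (u : 'rV[R]_n) t,
    (forall i, i \in s -> u 0 i = vreg st v 0 i) ->
    foldl (fun o i => obind (fun st' =>
        run g lmo S_lin k.+1 (SetCoord v i (e i)) (tick 1 st')) o)
      (Some (State (sreg st) (upd (vreg st) v u) t (grad_calls st) (lmo_calls st))) s =
    Some (State (sreg st)
            (upd (vreg st) v (\row_i (if i \in s then w 0 i else u 0 i)))
            (t + size s * c.+2) (grad_calls st) (lmo_calls st)).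
  elim: s => [_ u t _|i s IHs /= /andP[nis us] u t uold].
    rewrite /= mul0n addn0; congr (Some (State _ (upd _ _ _) _ _ _)).
    by apply/rowP => j; rewrite mxE.
  rewrite /tick/= ec (ew i u) ?uold ?mem_head// upd_same upd_upd.
  rewrite (IHs us) => [|j js]; last first.
    rewrite mxE; case: eqP js nis => [-> ->//|_ js _].
    by rewrite uold// inE js orbT.
  congr (Some (State _ (upd _ _ _) _ _ _)); last by rewrite mulSn -!addnA.
  apply/rowP => j; rewrite !mxE inE.
  by case: (eqVneq j i) => [->|]//=; rewrite (negbTE nis).
have := loop (enum 'I_n) (enum_uniq _) (vreg st v) (clock st) (fun _ _ => erefl).
rewrite upd_id -cardE card_ord; case: st ew loop => //= sr vr t gc lc ew loop ->.
congr (Some (State _ (upd _ _ _) _ _ _)).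
by apply/rowP => j; rewrite mxE mem_enum.
Qed.

Fixpoint fw_iter (k : nat) : 'rV[R]_n :=
  if k is j.+1 then fw_iter j + eps *: lmo j (g (fw_iter j)) else 0.

Definition fw_body : cmd R n :=
  Seq (QueryGrad g_reg y_reg)
  (Seq (MaxLinear s_reg g_reg)
  (Seq (ForCoord (fun i => SetCoord y_reg i
          (Add (Coord y_reg i) (Mul (Lit eps) (Coord s_reg i)))))
  (SetScal t_reg (Add (Scal t_reg) (Lit eps))))).

(** The loop invariant; the number of maximizations performed matters because it
    selects the tie-breaking of the next one. *)
Definition fw_at (k : nat) (st : state R n) : Prop :=
  [/\ sreg st t_reg = k%:R * eps, vreg st y_reg = fw_iter k & lmo_calls st = k].

Lemma run_fw_body fuel k st : fw_at k st -> exists st',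
  [/\ run g lmo S_lin fuel.+4.+1 fw_body st = Some st', fw_at k.+1 st',
      clock st' = (clock st + (4 + 7 * n + S_lin))%N
    & grad_calls st' = (grad_calls st).+1].
Proof.
case: st => sr vr t gc lc [/= tk yk lk].
set y' := fw_iter k.+1.
eexists; split.
- rewrite -[LHS]/(obind (run g lmo S_lin fuel.+2
      (SetScal t_reg (Add (Scal t_reg) (Lit eps))))
    (run g lmo S_lin fuel.+2 (ForCoord (fun i => SetCoord y_reg i
          (Add (Coord y_reg i) (Mul (Lit eps) (Coord s_reg i)))))
      (State sr
        (upd (upd vr g_reg (g (vr y_reg))) s_reg (lmo lc (g (vr y_reg))))
        (t + S_lin) gc.+1 lc.+1))).
  rewrite (@run_ForCoord_SetCoord _ _ _ _ y' 5)//=.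
  move=> i u t'; rewrite /upd/= => ->.
  by rewrite !mxE lk yk.
- split=> //=; rewrite ?lk//.
  by rewrite /upd/= tk -[k.+1]addn1 natrD mulrDl mul1r.
- by rewrite /=; lia.
- by [].
Qed.

(** Induction on the number [j] of iterations left. The guard is exact: after [k]
    iterations the register [t_reg] holds [k%:R * eps], which is less than 1
    precisely when [k < m]. The final failing test accounts for 3 units. *)
Lemma run_fw_loop m j k st : eps^-1 = m%:R -> 0 < eps -> (k + j)%N = m ->
  fw_at k st -> exists st',
  [/\ run g lmo S_lin j.+4.+2
        (WhileLt (Scal t_reg) (Lit 1) fw_body) st = Some st',
      vreg st' y_reg = fw_iter m,
      clock st' = (clock st + j * (7 + 7 * n + S_lin) + 3)%N
    & grad_calls st' = (grad_calls st + j)%N].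
Proof.
move=> epsm eps0; have m0 : m%:R != 0 :> R by rewrite -epsm invr_neq0 ?lt0r_neq0.
have epsE : eps = m%:R^-1 by rewrite -epsm invrK.
have test i : (i%:R * eps < 1) = (i < m)%N.
  by rewrite epsE ltr_pdivrMr ?mul1r ?ltr_nat// lt0r m0 ler0n.
elim: j k st => [|j IHj] k st.
  rewrite addn0 => -> [tk yk lk]; eexists; split.
  - by rewrite /= tk test ltnn.
  - by [].
  - by rewrite /=; lia.
  - by rewrite /= addn0.
move=> kj atk.
have atk' : fw_at k (tick 3 st) by case: atk.
have [st1 [run1 at1 clock1 grad1]] := run_fw_body j.+1 atk'.
have [|st2 [run2 y2 clock2 grad2]] := IHj k.+1 st1 _ at1; first by lia.
exists st2; split=> //.
- have [tk _ _] := atk.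
  rewrite -[run _ _ _ _ _ _]/(if sreg st t_reg < 1 then
    obind (run g lmo S_lin j.+4.+2 (WhileLt (Scal t_reg) (Lit 1) fw_body))
     (run g lmo S_lin j.+4.+2 fw_body (tick 3 st)) else Some (tick 3 st)).
  rewrite tk test ifT; last by lia.
  by rewrite run1.
- by rewrite clock2 clock1 /=; lia.
- by rewrite grad2 grad1 /=; lia.
Qed.

Lemma run_greedy_frank_wolfe m : eps^-1 = m%:R -> 0 < eps ->
  exists st : state R n,
  [/\ run g lmo S_lin m.+4.+4 (greedy_frank_wolfe n eps) (init_state R n)
        = Some st,
      output st = fw_iter m,
      clock st = (5 + 3 * n + m * (7 + 7 * n + S_lin))%N
    & grad_calls st = m].
Proof.
move=> epsm eps0.
pose st0 : state R n :=
  State (upd (fun=> 0) t_reg 0) (upd (fun=> 0) y_reg 0) (2 + 3 * n) 0 0.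
have [|//|//||st [runst yst clockst gradst]] := @run_fw_loop m m 0 st0.
- by [].
- by split; rewrite //= mul0r.
exists st; split=> //.
- have init : run g lmo S_lin m.+4.+2
     (ForCoord (fun i : 'I_n => SetCoord y_reg i (Lit 0)))
     (State (upd (fun=> 0) t_reg 0) (fun=> 0) 2 0 0) = Some st0.
    rewrite (@run_ForCoord_SetCoord _ _ _ _ 0 1)//=; first by rewrite mulnC.
    by move=> i u t _; rewrite mxE.
  rewrite -[LHS]/(obind (run g lmo S_lin m.+4.+2 (WhileLt (Scal t_reg) (Lit 1) fw_body))
    (run g lmo S_lin m.+4.+2 (ForCoord (fun i : 'I_n => SetCoord y_reg i (Lit 0)))
     (State (upd (fun=> 0) t_reg 0) (fun=> 0) 2 0 0))).
  by rewrite init.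
- by rewrite clockst /=; lia.
Qed.

End Run.

(** * Convergence of the iterates *)

(** Each of the [k] steps adds [eps] times a point of the cube. *)
Lemma fw_iter_itv (R : realType) (n : nat) (P : set 'rV[R]_n) g lmo (eps : R) k i :
  P `<=` cube R n -> linear_maximizer P lmo -> 0 <= eps ->
  0 <= fw_iter g lmo eps k 0 i <= k%:R * eps.
Proof.
move=> PC lmoP eps0; elim: k => [|k IHk]; first by rewrite mxE mul0r lexx.
have := PC _ (lmoP k (g (fw_iter g lmo eps k))).1 i.
rewrite /= !mxE -[k.+1]addn1 natrD mulrDl mul1r; nra.
Qed.

(** Unrolling [greedy_step]. The errors of the earlier steps are shrunk as well,
    but bounding each of them by its initial size is enough. *)
Lemma fw_iter_gap (R : realType) (n : nat) (P : set 'rV[R]_n)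
    (G C : 'rV[R]_n -> R) (L D eps : R) (o : 'rV[R]_n) lmo (m k : nat) :
  let F x := G x + C x in
  let y := fw_iter (grad F) lmo eps in
  P `<=` cube R n -> linear_maximizer P lmo ->
  nonneg_on_cube G -> monotone_on_cube G -> smooth L G -> DR_submodular G ->
  nonneg_on_cube C -> monotone_on_cube C -> smooth L C -> concave_on_cube C ->
  (forall x, P x -> enorm x <= D) -> 0 <= L -> P o ->
  0 < eps <= 1 -> m%:R * eps = 1 -> (k <= m)%N ->
  F o - F (y k) <= (1 - eps) ^+ k * F o + k%:R * (2 * (eps ^+ 2 * (L * D ^+ 2))).
Proof.
move=> F y PC lmoP G0 Gm Gs GDR C0 Cm Cs Cc PD L0 Po /andP[eps0 eps1] meps.
set B := 2 * _; have B0 : 0 <= B.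
  by rewrite mulr_ge0// mulr_ge0 ?sqr_ge0// mulr_ge0 ?sqr_ge0.
elim: k => [_|k IHk km].
  rewrite expr0 mul1r mul0r addr0 gerBl /F.
  have c0 : cube R n 0 by move=> i; rewrite mxE lexx ler01.
  by rewrite addr_ge0 ?G0 ?C0.
have yk i : 0 <= y k 0 i <= 1 - eps.
  have /andP[-> /le_trans ->//] := fw_iter_itv (grad F) k i PC lmoP (ltW eps0).
  have : k.+1%:R * eps <= m%:R * eps by rewrite ler_pM2r// ler_nat.
  by rewrite meps -addn1 natrD mulrDl mul1r; lra.
have step : eps * (F o - F (y k)) - B <= F (y k.+1) - F (y k).
  exact: greedy_step PC Gm Gs GDR Cm Cs Cc PD L0 eps0 yk Po (lmoP _ _).
have e1 : 0 <= 1 - eps by rewrite subr_ge0.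
have {}IHk := ler_wpM2l e1 (IHk (ltnW km)).
have kB : 0 <= eps * (k%:R * B) by rewrite mulr_ge0 ?(ltW eps0)// mulr_ge0.
rewrite exprS -mulrA (natrD _ 1 k : k.+1%:R = _).
move: (F o) (F (y k)) (F (y k.+1)) step IHk => Fo Fk Fk1; lra.
Qed.

Lemma expr_onem_le_expRN1 (R : realType) (eps : R) (m : nat) :
  eps <= 1 -> m%:R * eps = 1 -> (1 - eps) ^+ m <= 1 / expR 1.
Proof.
move=> eps1 meps; rewrite div1r -expRN -[X in expR (- X)]meps -mulrN expRM_natl.
by rewrite lerXn2r ?nnegrE ?expR_ge0 ?subr_ge0//; exact: expR_ge1Dx.
Qed.

Theorem theorem3p3 (R : realType) :
  exists c_time c_calls c_err : nat,
  forall (n : nat) (P : set 'rV[R]_n) (G C : 'rV[R]_n -> R) (L D eps : R)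
    (o : 'rV[R]_n) (S_lin : nat) (lmo : nat -> 'rV[R]_n -> 'rV[R]_n),
  let F := fun x => G x + C x in
  (0 < n)%N ->
  convex_body P -> P `<=` cube R n ->
  linear_maximizer P lmo ->
  nonneg_on_cube G -> monotone_on_cube G -> smooth L G -> DR_submodular G ->
  nonneg_on_cube C -> monotone_on_cube C -> smooth L C -> concave_on_cube C ->
  argmax P F o ->
  is_max P (@enorm R n) D ->
  0 < eps < 1 -> eps^-1 \is a Num.int ->
  exists (fuel : nat) (st : state R n),
    [/\ run (grad F) lmo S_lin fuel (greedy_frank_wolfe n eps) (init_state R n)
          = Some st,
        (clock st)%:R <= c_time%:R * (eps^-1 * (n + S_lin)%:R),
        (grad_calls st)%:R <= c_calls%:R * eps^-1
      & F (output st) >=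
          (1 - 1 / expR 1) * F o - c_err%:R * (eps * L * D ^+ 2)].
Proof.
(* The clock shows 5 + 3 n + m (7 + 7 n + S_lin), where n and m are at least 1:
   hence at most 8 n m for start and exit, and 14 n m + m S_lin for the loop.
   The error constant is 2 because G and C are each L-smooth. *)
exists 22%N, 1%N, 2%N => n P G C L D eps o S_lin lmo F n0 _ PC lmoP.
move=> G0 Gm Gs GDR C0 Cm Cs Cc [Po omax] [x [Px xmax] xD] /andP[eps0 eps1] epsZ.
have /natrP[m epsm] : eps^-1 \is a Num.nat by rewrite natrEint epsZ invr_ge0 ltW.
have meps : m%:R * eps = 1 by rewrite -epsm mulVf// lt0r_neq0.
have m_gt0 : (0 < m)%N by rewrite -(ltr_nat R) -epsm invr_gt0.
have [st [runst yst clockst callst]] :=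
  run_greedy_frank_wolfe (grad F) lmo S_lin epsm eps0.
exists m.+4.+4, st; split=> //.
- by rewrite epsm -!natrM ler_nat clockst; nia.
- by rewrite callst epsm mul1r.
have PD z : P z -> enorm z <= D by rewrite -xD; exact: xmax.
have eps01 : 0 < eps <= 1 by rewrite eps0 ltW.
have Fo : 0 <= F o by rewrite addr_ge0 ?G0 ?C0//; exact: PC.
have decay := ler_wpM2r Fo (expr_onem_le_expRN1 (ltW eps1) meps).
have gap : F o - F (output st) <= (1 - eps) ^+ m * F o +
    m%:R * (2 * (eps ^+ 2 * (L * D ^+ 2))).
  rewrite yst; exact: fw_iter_gap PC lmoP G0 Gm Gs GDR C0 Cm Cs Cc PD
    (smooth_const_ge0 n0 Gs) Po eps01 meps (leqnn m).
have errE : m%:R * (2 * (eps ^+ 2 * (L * D ^+ 2))) = 2 * (eps * L * D ^+ 2).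
  rewrite -[RHS]mul1r -[X in _ = X * _]meps; ring.
rewrite errE in gap; move: (F o) (F (output st)) (1 / expR 1) decay gap => ? ? ?.
lra.
Qed.
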